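(* Let $\{\hat F_\mu:\mu\in U\}$ be of Riemann-Lebesgue type at $\mu_0$ on $U$, let $\omega$ be admissible, and define $K:\mathbb{R}^2\to\mathbb{R}$ by $$K(t,x;\mu_0)=\int_{[-1,1]}\frac{\omega(s)\cos\{tsx-h_{\mu_0}(ts)\}}{r_{\mu_0}(ts)}\,ds .$$ Then the function $\psi(t,\mu;\mu_0)=\int K(t,x;\mu_0)\,dF_\mu(x)$ satisfies the following: 1. $\psi(\cdot,\cdot;\mu_0):\mathbb{R}\times U\to\mathbb{R}$ with $$\psi(t,\mu;\mu_0)=\int_{[-1,1]}\omega(s)\frac{r_\mu(ts)}{r_{\mu_0}(ts)}\cos\{h_\mu(ts)-h_{\mu_0}(ts)\}\,ds .$$ 2. $\psi(t,\mu_0;\mu_0)=1$ for all $t$, and $\lim_{t\to\infty}\psi(t,\mu;\mu_0)=0$ for each $\mu\in U$ such that $\mu\ne\mu_0$.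
   Context: $\mathcal{F}=\{F_\mu:\mu\in U\}$ is a family of cumulative distribution functions (CDFs) on $\mathbb{R}$, where $U\subseteq\mathbb{R}$ has non-empty interior, each $F_\mu$ is uniquely determined by $\mu$, and $\mu_0\in U$ is fixed. $\hat F_\mu(t)=\int e^{\iota tx}dF_\mu(x)$, $\iota=\sqrt{-1}$, is the characteristic function of $F_\mu$, $r_\mu=|\hat F_\mu|$ is its modulus and $h_\mu$ its argument, so $\hat F_\mu=r_\mu e^{\iota h_\mu}$ (if $\hat F_\mu$ has no real zeros, $h_\mu$ can be taken to be the continuous odd version with $h_\mu(0)=0$). $\{\hat F_\mu:\mu\in U\}$ is of Riemann-Lebesgue type (RL type) at $\mu_0$ on $U$ if: (i) $\hat F_{\mu_0}(t)\neq 0$ for all $t\in\mathbb{R}$; and for each $\mu\in U\setminus\{\mu_0\}$, (ii) $\sup_{t\in\mathbb{R}} r_\mu(t)/r_{\mu_0}(t)<\infty$ and (iii) $\lim_{t\to\infty}\frac1t\int_{[-t,t]}\frac{\hat F_\mu(y)}{\hat F_{\mu_0}(y)}\,dy=0$. A function $\omega:[-1,1]\to\mathbb{R}$ is admissible if it is non-negative and bounded with $\int_{[-1,1]}\omega(s)\,ds=1$. *)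

(* Defs.v *)
From HB Require Import structures.
From mathcomp Require Import all_boot all_order all_algebra.
From mathcomp Require Export complex.
From mathcomp Require Export all_classical all_reals all_analysis.

Set Implicit Arguments.
Unset Strict Implicit.
Unset Printing Implicit Defensive.

Import Order.TTheory GRing.Theory Num.Theory.
Import numFieldTopology.Exports numFieldNormedType.Exports.

Local Open Scope classical_set_scope.
Local Open Scope complex_scope.
Local Open Scope ring_scope.

Definition expi (R : realType) (y : R) : R[i] := cos y +i* sin y.

Definition Cintegral d (T : measurableType d) (R : realType)
    (m : {measure set T -> \bar R}) (D : set T) (f : T -> R[i]) : R[i] :=
  (\int[m]_(x in D) complex.Re (f x))%R +i* (\int[m]_(x in D) complex.Im (f x))%R.

(* CDFs are the inhabitants of [cumulativeBounded 0 1]: nondecreasing,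
   right-continuous, with limits 0 at -oo and 1 at +oo. *)
Definition charf (R : realType) (G : cumulativeBounded (0 : R) (1 : R))
    (t : R) : R[i] :=
  Cintegral (lebesgue_stieltjes_measure G) setT (fun x => expi (t * x)).

Definition charf_mod (R : realType) (G : cumulativeBounded (0 : R) (1 : R))
    (t : R) : R :=
  ComplexField.Normc.normc (charf G t).

(* No continuity or choice of branch is imposed, and [h t] is unconstrained
   where the characteristic function vanishes. *)
Definition is_charf_arg (R : realType)
    (G : cumulativeBounded (0 : R) (1 : R)) (h : R -> R) : Prop :=
  forall t, charf G t = (charf_mod G t)%:C * expi (h t).

Definition RL_type (R : realType) (U : set R)
    (F : R -> cumulativeBounded (0 : R) (1 : R)) (mu0 : R) : Prop :=
  (forall t, charf (F mu0) t != 0) /\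
  (forall mu, U mu -> mu != mu0 ->
     (ereal_sup (range (fun t =>
        (charf_mod (F mu) t / charf_mod (F mu0) t)%:E)) < +oo)%E /\
     (t^-1%:C * Cintegral (@lebesgue_measure R) `[- t, t]
        (fun y => charf (F mu) y / charf (F mu0) y))
       @[t --> +oo] --> (0 : R[i]^o)).

(* The domain of [completed_lebesgue_measure] carries the Lebesgue (rather than
   Borel) sigma-algebra, so that weights are only required to be Lebesgue
   measurable. Only the values of [w] on [-1, 1] matter. *)
Definition lebesgue_type (R : realType) :=
  caratheodory_type ((@wlength R idfun)^*)%mu.

Definition itv11 (R : realType) : set (lebesgue_type R) := `[(-1 : R), 1].

Definition admissible (R : realType) (w : R -> R) : Prop :=
  [/\ measurable_fun (@itv11 R) (w : lebesgue_type R -> R),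
      {in `[-1, 1]%R, forall s, 0 <= w s},
      exists M : R, {in `[-1, 1]%R, forall s, `|w s| <= M} &
      (\int[@completed_lebesgue_measure R]_(s in @itv11 R) (w s)%:E = 1)%E].

(* [G] and [h] stand for the CDF at the base point and the argument of its
   characteristic function. *)
Definition K_integrand (R : realType) (w : R -> R)
    (G : cumulativeBounded (0 : R) (1 : R)) (h : R -> R)
    (t x : R) (s : lebesgue_type R) : R :=
  w s * cos (t * s * x - h (t * s)) / charf_mod G (t * s).

Definition K (R : realType) (w : R -> R)
    (G : cumulativeBounded (0 : R) (1 : R)) (h : R -> R) (t x : R) : R :=
  (\int[@completed_lebesgue_measure R]_(s in @itv11 R)
    K_integrand w G h t x s)%R.

Definition psi (R : realType) (w : R -> R)
    (F : R -> cumulativeBounded (0 : R) (1 : R)) (mu0 : R) (h0 : R -> R)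
    (t mu : R) : R :=
  (\int[lebesgue_stieltjes_measure (F mu)]_x K w (F mu0) h0 t x)%R.

(* Main.v *)
Require Import Defs.
From mathcomp Require Import all_boot all_order all_algebra.
From mathcomp Require Import complex all_classical all_reals all_analysis.
From mathcomp Require Import measurable_realfun ring lra.

(** The phase [h mu0] enters only through its cosine and sine, so the kernel can
be rewritten with the real and imaginary parts of the reciprocal of
[charf (F mu0)] (lemma [invcharf_cos]). These are continuous, since
characteristic functions are continuous and this one never vanishes; hence they
are bounded on compact sets, [K] is well defined, and the integrals over [x] and
[s] may be exchanged ([Rintegral_fubini]). The inner integral over [x] then
produces the characteristic function of [F mu], and one obtains
[[
  psi t mu = \int_[-1, 1] w s * g (t * s) ds,
  g = Re (charf (F mu) / charf (F mu0)),
]]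
([Rintegral_K]), which is the announced formula by [ratio_reE]. For [mu = mu0]
the function [g] is constantly 1 and the integral is that of [w].

For [mu != mu0], [g] is continuous, even (a characteristic function at [- y] is
the conjugate of its value at [y]), and by [RL_type] it is bounded with means
over the intervals [`[- t, t]] that tend to 0. The limit is then an instance of
a Riemann-Lebesgue lemma ([mean_zero_riemann_lebesgue]) for arbitrary integrable
weights. If [w] is the indicator of [`[-1, b]], the change of variable
[y = t * s] and the evenness of [g] express the integral by means of [g] over
symmetric intervals ([scaled_itv_mean0]). The set of weights for which the limit
is 0 is linear and, since [g] is bounded, closed in L1; so the corresponding
sets form a lambda-system, which by the pi-lambda theorem contains the Borel
sets, hence up to null sets the Lebesgue measurable sets; density of simple
functions in L1 concludes ([weakly_null_lebesgue]). *)

Import Order.TTheory GRing.Theory Num.Theory.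
Import numFieldTopology.Exports numFieldNormedType.Exports.

Local Open Scope classical_set_scope.
Local Open Scope ring_scope.

Set Implicit Arguments.
Unset Strict Implicit.
Unset Printing Implicit Defensive.

(** * Test functions against which a bounded family tends to zero *)

Section real_integrable.
Context d (T : measurableType d) (R : realType).
Context (mu : {measure set T -> \bar R}) (D : set T) (mD : measurable D).

Lemma integrable_fin_add (f g : T -> R) :
  mu.-integrable D (EFin \o f) -> mu.-integrable D (EFin \o g) ->
  mu.-integrable D (EFin \o (fun x => f x + g x)).
Proof. exact: integrableD. Qed.

Lemma integrable_fin_sub (f g : T -> R) :
  mu.-integrable D (EFin \o f) -> mu.-integrable D (EFin \o g) ->
  mu.-integrable D (EFin \o (fun x => f x - g x)).
Proof. exact: integrableB. Qed.

Lemma integrable_fin_scale (c : R) (f : T -> R) :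
  mu.-integrable D (EFin \o f) -> mu.-integrable D (EFin \o (fun x => c * f x)).
Proof. exact: integrableZl. Qed.

End real_integrable.

Section weakly_null.
Context d (T : measurableType d) (R : realType).
Context (mu : {measure set T -> \bar R}) (D : set T).
Context (I : Type) (F : set_system I) {FF : Filter F}.
Context (phi : I -> T -> R) (M : R).
Hypotheses (mD : measurable D) (muD : (mu D < +oo)%E).
Hypothesis mphi : forall i, measurable_fun D (phi i).
Hypothesis phiM : forall i x, D x -> `|phi i x| <= M.

(** With [mu D] finite and the [phi i] uniformly bounded, this says that the
family [phi] tends to 0 against the test function [f] along [F]; for all
integrable [f] together it is weak-star convergence to 0 in the dual of L1. *)
Definition weakly_null (f : T -> R) : Prop :=
  \int[mu]_(x in D) (f x * phi i x) @[i --> F] --> (0 : R).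

Lemma integrable_mul_phi (f : T -> R) (i : I) :
  mu.-integrable D (EFin \o f) ->
  mu.-integrable D (EFin \o (fun x => f x * phi i x)).
Proof.
move=> intf; apply: (integrableMl mD intf (mphi i)).
exists M; split; first exact: num_real.
by move=> y My x /= Dx; rewrite (le_trans (phiM i Dx)) ?ltW.
Qed.

Lemma weakly_null0 : weakly_null (fun=> 0).
Proof.
rewrite /weakly_null; under eq_fun do under eq_Rintegral do rewrite mul0r.
by under eq_fun do rewrite Rintegral_cst// mul0r; exact: cvg_cst.
Qed.

Lemma weakly_nullD (f g : T -> R) :
  mu.-integrable D (EFin \o f) -> mu.-integrable D (EFin \o g) ->
  weakly_null f -> weakly_null g -> weakly_null (fun x => f x + g x).
Proof.
move=> intf intg f0 g0; rewrite /weakly_null -[X in _ --> X]addr0.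
rewrite (_ : (fun i => _) = (fun i => \int[mu]_(x in D) (f x * phi i x) +
                                     \int[mu]_(x in D) (g x * phi i x))).
  exact: cvgD f0 g0.
apply/funext => i; rewrite /= -RintegralD//; try exact: integrable_mul_phi.
by apply: eq_Rintegral => x _; rewrite mulrDl.
Qed.

Lemma weakly_nullZ (c : R) (f : T -> R) : mu.-integrable D (EFin \o f) ->
  weakly_null f -> weakly_null (fun x => c * f x).
Proof.
move=> intf f0; rewrite /weakly_null -[X in _ --> X](mulr0 c).
rewrite (_ : (fun i => _) = (fun i => c * \int[mu]_(x in D) (f x * phi i x))).
  exact: cvgMl_tmp f0.
apply/funext => i; rewrite /= -RintegralZl//; last exact: integrable_mul_phi.
by apply: eq_Rintegral => x _; rewrite mulrA.
Qed.

Lemma weakly_nullB (f g : T -> R) :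
  mu.-integrable D (EFin \o f) -> mu.-integrable D (EFin \o g) ->
  weakly_null f -> weakly_null g -> weakly_null (fun x => f x - g x).
Proof.
move=> intf intg f0 g0.
under eq_fun do rewrite -mulN1r.
apply: weakly_nullD => //; last exact: weakly_nullZ.
exact: integrable_fin_scale.
Qed.

Lemma weakly_null_eq (f g : T -> R) : {in D, f =1 g} ->
  weakly_null f -> weakly_null g.
Proof.
move=> fg; rewrite /weakly_null.
suff -> : (fun i => \int[mu]_(x in D) (f x * phi i x))
        = (fun i => \int[mu]_(x in D) (g x * phi i x)) by [].
by apply/funext => i; apply: eq_Rintegral => x xD; rewrite fg.
Qed.

(** The functionals that integrate against [phi i] are Lipschitz for the L1
norm with one common constant, so the set of test functions along which they tend
to 0 is closed. *)
Lemma weakly_null_L1_closed (f : T -> R) : mu.-integrable D (EFin \o f) ->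
  (forall e, 0 < e -> exists g : T -> R, [/\ mu.-integrable D (EFin \o g),
     weakly_null g & \int[mu]_(x in D) `|f x - g x| < e]) ->
  weakly_null f.
Proof.
move=> intf fg; apply/cvgrPdist_lt => e e0.
have M1 : 0 < `|M| + 1 by rewrite ltr_wpDl.
have [|g [intg g0 ge]] := fg (e / 2 / (`|M| + 1)); first by rewrite !divr_gt0.
move/cvgrPdist_lt/(_ (e / 2)) : g0; rewrite divr_gt0// => /(_ isT).
apply: filterS => i; rewrite !sub0r !normrN => gi.
have intB : mu.-integrable D (EFin \o (fun x => f x - g x)).
  exact: integrable_fin_sub.
have -> : \int[mu]_(x in D) (f x * phi i x) =
    \int[mu]_(x in D) (g x * phi i x) +
    \int[mu]_(x in D) ((f x - g x) * phi i x).
  rewrite -RintegralD//; try exact: integrable_mul_phi.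
  by apply: eq_Rintegral => x _; rewrite -mulrDl addrC subrK.
rewrite (le_lt_trans (ler_normD _ _))// (splitr e) ltrD//.
apply: (@le_lt_trans _ _ ((`|M| + 1) * \int[mu]_(x in D) `|f x - g x|)).
  have intA : mu.-integrable D (EFin \o (fun x => `|f x - g x|)).
    exact: integrable_norm.
  rewrite (le_trans (le_normr_Rintegral _ _))//.
    exact: integrable_mul_phi.
  rewrite -RintegralZl//; apply: le_Rintegral => //.
  - by apply: integrable_norm => //; exact: integrable_mul_phi.
  - exact: integrable_fin_scale.
  - move=> x Dx; rewrite normrM mulrC ler_wpM2r//.
    by rewrite (le_trans (phiM i Dx))// (le_trans (ler_norm _))// lerDl.
by rewrite mulrC -ltr_pdivlMr.
Qed.

Lemma weakly_null_sum (J : Type) (s : seq J) (f : J -> T -> R) :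
  (forall j, mu.-integrable D (EFin \o f j)) ->
  (forall j, weakly_null (f j)) -> weakly_null (fun x => \sum_(j <- s) f j x).
Proof.
move=> intf f0.
suff [] : mu.-integrable D (EFin \o (fun x => \sum_(j <- s) f j x)) /\
          weakly_null (fun x => \sum_(j <- s) f j x) by [].
elim: s => [|j s [ints s0]].
  rewrite (_ : (fun x => _) = fun=> 0); last first.
    by apply/funext => x; rewrite big_nil.
  by split; [exact: integrable0|exact: weakly_null0].
have -> : (fun x => \sum_(k <- j :: s) f k x) =
          (fun x => f j x + \sum_(k <- s) f k x).
  by apply/funext => x; rewrite big_cons.
split; last exact: weakly_nullD.
exact: integrable_fin_add.
Qed.

Lemma integrable_indic_finite (A : set T) : measurable A ->
  mu.-integrable D (EFin \o (\1_A : T -> R)).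
Proof.
move=> mA; apply: measurable_bounded_integrable => //.
exists 1; split; first exact: num_real.
move=> y y1 x _ /=; rewrite (le_trans _ (ltW y1))// indicE.
by case: (x \in A); rewrite ?normr1 ?normr0.
Qed.

(** Proper differences are handled by linearity. For an increasing union, the
indicators converge in L1 because [mu] is continuous from above on [D]. This
is what makes the pi-lambda theorem applicable. *)
Lemma weakly_null_indic_lambda :
  weakly_null (cst 1) ->
  lambda_system [set: T] [set A | measurable A /\ weakly_null \1_A].
Proof.
move=> T0; split => //=.
- split; first exact: measurableT.
  by rewrite indicT.
- move=> A B BA [mA A0] [mB B0]; split; first exact: measurableD.
  have := weakly_nullB (integrable_indic_finite mA)
                       (integrable_indic_finite mB) A0 B0.
  apply: weakly_null_eq => x _; rewrite !indicE in_setD.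
  case: (boolP (x \in B)) => [/set_mem/BA/mem_set ->|_].
    by rewrite subrr.
  by rewrite andbT subr0.
- move=> A ndA /all_and2[mA A0].
  have mU : measurable (\bigcup_n A n) by exact: bigcup_measurable.
  split => //; apply: weakly_null_L1_closed => [|e e0].
    exact: integrable_indic_finite.
  have : mu (D `&` (\bigcup_n A n `\` A n)) @[n --> \oo] --> 0%E.
    have <- : mu (\bigcap_n (D `&` (\bigcup_k A k `\` A n))) = 0%E.
      rewrite (_ : \bigcap_n _ = set0) ?measure0//.
      rewrite -subset0 => x Ax; have [_ [[n _ An] _]] := Ax 0%N Logic.I.
      by have [_ [_]] := Ax n Logic.I; exact.
    apply: nonincreasing_cvg_mu => //.
    + rewrite (le_lt_trans _ muD)// le_measure ?inE//.
      by apply: measurableI => //; exact: measurableD.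
    + by move=> n; apply: measurableI => //; exact: measurableD.
    + apply: bigcapT_measurable => n.
      by apply: measurableI => //; exact: measurableD.
    + move=> m n mn; apply/subsetPset => x [Dx [Ux nAx]]; split => //.
      split => //; apply: contra_not nAx.
      by have /subsetPset := ndA _ _ mn; exact.
  move=> /fine_cvgP[_ /cvgrPdist_lt/(_ _ e0)] [N _ /(_ N (leqnn N))].
  rewrite /= sub0r normrN => Ne.
  exists \1_(A N); split => //; first exact: integrable_indic_finite.
  have mUN : measurable (\bigcup_n A n `\` A N) by exact: measurableD.
  have -> : \int[mu]_(x in D) `|\1_(\bigcup_n A n) x - \1_(A N) x| =
            \int[mu]_(x in D) \1_(\bigcup_n A n `\` A N) x.
    apply: eq_Rintegral => x _; rewrite !indicE in_setD.
    have [/set_mem AN|_] := boolP (x \in A N); last first.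
      by rewrite subr0 andbT normr_nat.
    by rewrite mem_set ?subrr ?normr0//; exists N.
  rewrite /Rintegral integral_indic// setIC.
  by rewrite (le_lt_trans _ Ne)// ler_norm.
Qed.

Import HBSimple.

(** Simple functions are finite combinations of indicators and are dense
in L1. *)
Lemma weakly_null_of_indic (f : T -> R) :
  (forall A, measurable A -> weakly_null \1_A) ->
  mu.-integrable D (EFin \o f) -> weakly_null f.
Proof.
move=> indic0 intf; apply: weakly_null_L1_closed => // e e0.
have [g [intg _ fg]] := approximation_sfun_integrable mD intf.
move: fg => /fine_cvgP[_ /cvgrPdist_lt/(_ _ e0)] [N _ /(_ N (leqnn N))].
rewrite /= sub0r normrN => Ne.
exists (g N); split => //; last by rewrite (le_lt_trans _ Ne)// ler_norm.
(* a simple function is the finite sum of its values times the indicators of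
   its level sets *)
have -> : (g N : T -> R) = (fun x =>
    \sum_(y <- finmap.enum_fset (fset_set (range (g N))))
      y * \1_(g N @^-1` [set y]) x).
  by apply/funext => x; rewrite {1}fimfunE fsbig_finite.
have mgy y : measurable (g N @^-1` [set y]) by [].
apply: weakly_null_sum => y.
  by apply: integrable_fin_scale => //; exact: integrable_indic_finite.
apply: weakly_nullZ; first exact: integrable_indic_finite.
exact: indic0.
Qed.

End weakly_null.

(** * Completed Lebesgue measure *)

Section completed_lebesgue.
Context (R : realType).
Local Notation lambda := (@completed_lebesgue_measure R).
Local Notation D := (@itv11 R).

Lemma measurable_completed (A : set R) :
  measurable A -> measurable (A : set (lebesgue_type R)).
Proof. exact: sub_caratheodory. Qed.

Lemma measurable_itv11 : measurable D.
Proof. exact: (measurable_completed (measurable_itv `[-1, 1])). Qed.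

Lemma completed_lebesgueE (A : set R) : lambda A = lebesgue_measure A.
Proof. by []. Qed.

Lemma completed_itv11_lty : (lambda D < +oo)%E.
Proof.
rewrite completed_lebesgueE lebesgue_measure_itv/= lte_fin.
by case: ifP; rewrite ltry.
Qed.

Lemma measurable_id_completed :
  measurable_fun setT (idfun : lebesgue_type R -> R).
Proof. by move=> _ A mA; rewrite setTI; exact: measurable_completed. Qed.

(** The Borel measure is the image of the completed one under the identity,
which is measurable from the larger sigma-algebra to the smaller one. *)
Lemma ge0_integral_completed (A : set R) (f : R -> \bar R) :
  measurable A -> measurable_fun setT f -> (forall x, 0 <= f x)%E ->
  (\int[lambda]_(x in (A : set (lebesgue_type R))) f x =
   \int[lebesgue_measure]_(x in A) f x)%E.
Proof.
move=> mA mf f0.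
have := @ge0_integral_pushforward _ _ (lebesgue_type R) (measurableTypeR R) R
  idfun measurable_id_completed lambda A f mA (measurable_funTS mf)
  (fun x _ => f0 x).
by move=> <-.
Qed.

Lemma integral_completed (A : set R) (f : R -> \bar R) :
  measurable A -> measurable_fun setT f ->
  (\int[lambda]_(x in (A : set (lebesgue_type R))) f x =
   \int[lebesgue_measure]_(x in A) f x)%E.
Proof.
move=> mA mf; rewrite [LHS]integralE [RHS]integralE.
rewrite (ge0_integral_completed mA (measurable_funepos mf))//.
by rewrite (ge0_integral_completed mA (measurable_funeneg mf)).
Qed.

Context (I : Type) (F : set_system I) {FF : Filter F}.
Context (phi : I -> lebesgue_type R -> R) (M : R).
Hypotheses (mphi : forall i, measurable_fun D (phi i))
           (phiM : forall i x, D x -> `|phi i x| <= M).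
Local Notation null := (weakly_null lambda D F phi).

(** Three layers: the half-open intervals form a pi-system generating the Borel
sets, and their indicators are differences of indicators of half-lines; a
Lebesgue measurable set is a Borel set up to a null set; indicators suffice. *)
Lemma weakly_null_lebesgue (f : lebesgue_type R -> R) :
  (forall b, -1 <= b <= 1 -> null \1_(`[-1, b] : set R)) ->
  lambda.-integrable D (EFin \o f) -> null f.
Proof.
move=> null_itv.
have mD := measurable_itv11; have Dy := completed_itv11_lty.
apply: (weakly_null_of_indic _ _ mphi phiM) => // A mA.
have intI := @integrable_indic_finite _ _ R lambda D mD Dy.
have : (completed_algebra_gen (@lebesgue_measure R)).-sigma.-measurable A.
  by rewrite completed_caratheodory_measurable.
rewrite g_sigma_completed_algebra_genE => -[X mX [N [B [/= mB B0 NB]] XNA]].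
have {}mX : measurable (X : set R) by [].
have mX' := measurable_completed mX.
(* [X] is the Borel part of [A]; the rest of [A] lies in the null set [B] *)
suff X0 : null \1_X.
  apply: (weakly_null_L1_closed _ mphi phiM) => //; first exact: intI.
  move=> e e0; exists \1_X; split => //; first exact: intI.
  have -> : \int[lambda]_(x in D) `|\1_A x - \1_X x| =
            \int[lambda]_(x in D) \1_(A `\` X) x.
    apply: eq_Rintegral => x _; rewrite !indicE in_setD.
    have [/set_mem Xx|_] := boolP (x \in X); last first.
      by rewrite subr0 andbT normr_nat.
    by rewrite mem_set ?subrr ?normr0// -XNA; left.
  have mAX : measurable (A `\` X) by exact: measurableD.
  have L0 : lambda ((A `\` X) `&` D) = 0%E.
    apply/eqP; rewrite -measure_le0 -B0 -completed_lebesgueE le_measure ?inE//.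
    + exact: measurableI.
    + exact: measurable_completed.
    + by move=> x [[]]; rewrite -XNA => -[//|/NB].
  by rewrite /Rintegral integral_indic// [X in fine X]L0.
have ray b : null \1_(`]-oo, b] : set R).
  have [b1|b1] := ltP b (-1).
    apply: weakly_null_eq; last exact: weakly_null0 mD.
    move=> x.
    rewrite inE /itv11/= in_itv/= => /andP[x1 _].
    rewrite indicE memNset//= in_itv/= => xb.
    by have := le_lt_trans (le_trans x1 xb) b1; rewrite ltxx.
  have : -1 <= Num.min b 1 <= 1.
    by rewrite le_min b1 ge_min lexx orbT andbT/=; lra.
  move=> /null_itv; apply: weakly_null_eq => x.
  rewrite inE /itv11/= in_itv/= => /andP[x1 x2]; rewrite !indicE; congr (_%:R).
  congr nat_of_bool; apply/idP/idP;
    by rewrite !inE/= !in_itv/= le_min x1 x2 andbT.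
have : <<s setT, @ocitv R >> X by exact: mX.
suff : <<s setT, @ocitv R >> `<=`
    [set A | @measurable _ (lebesgue_type R) A /\ null \1_A].
  by move=> /[apply] -[].
apply: lambda_system_subset.
- exact: ocitvI.
- apply: (weakly_null_indic_lambda _ _ mphi phiM) => //.
  have m11 : -1 <= (1 : R) <= 1 by rewrite lexx andbT; lra.
  have := null_itv 1 m11; apply: weakly_null_eq => x xD.
  by rewrite indicE; move: xD => /set_mem; rewrite /itv11 => /mem_set ->.
- move=> _ [[a b] _ <-] /=; split.
    exact: (measurable_completed (measurable_itv `]a, b])).
  have [ab|ba] := leP a b; last first.
    rewrite set_itv_ge ?bnd_simp -?leNgt ?ltW// indic0.
    exact: weakly_null0.
  apply: (weakly_null_eq _ (weakly_nullB mD mphi phiM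
    (intI _ (measurable_completed (measurable_itv `]-oo, b])))
    (intI _ (measurable_completed (measurable_itv `]-oo, a])))
    (ray b) (ray a))) => x _.
  rewrite !indicE.
  have -> : (x \in `]a, b]%classic) = (a < x <= b).
    by apply/idP/idP; rewrite inE/= in_itv.
  have -> : (x \in `]-oo, a]%classic) = (x <= a).
    by apply/idP/idP; rewrite inE/= in_itv.
  have -> : (x \in `]-oo, b]%classic) = (x <= b).
    by apply/idP/idP; rewrite inE/= in_itv.
  by case: (ltP a x) => [_|xa]/=; rewrite ?subr0// (le_trans xa ab) subrr.
- by [].
Qed.

End completed_lebesgue.

(** * Even functions with mean zero *)

Lemma continuous_mul (R : realType) (f : R -> R) (t : R) : continuous f ->
  continuous (fun x => f (t * x)).
Proof.
by move=> cf s; apply: continuous_comp; [exact: mulrl_continuous|exact: cf].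
Qed.

Lemma cos_norm_le1 (R : realType) (x : R) : `|cos x| <= 1.
Proof. by rewrite ler_norml cos_geN1 cos_le1. Qed.

Lemma sin_norm_le1 (R : realType) (x : R) : `|sin x| <= 1.
Proof. by rewrite ler_norml sin_geN1 sin_le1. Qed.

Lemma continuous_bounded_segment (R : realType) (f : R -> R) : continuous f ->
  exists M, forall s, `[-1, 1]%classic s -> `|f s| <= M.
Proof.
move=> cf.
have [||c _ cM] := @EVT_max R (fun s => `|f s|) (-1) 1; first by lra.
  apply: continuous_subspaceT => s.
  by apply: continuous_comp; [exact: cf|exact: norm_continuous].
by exists `|f c|.
Qed.

Section mean_zero.
Context (R : realType) (g : R -> R).
Local Notation mu := (@lebesgue_measure R).
Hypothesis cg : continuous g.

Lemma integrable_continuous_itv (a b : R) (f : R -> R) : continuous f ->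
  mu.-integrable `[a, b] (EFin \o f).
Proof.
move=> cf; apply: continuous_compact_integrable; first exact: segment_compact.
exact: continuous_subspaceT.
Qed.

Lemma Rintegral_chasles (a b c : R) : a <= b -> b <= c ->
  \int[mu]_(x in `[a, c]) g x =
  \int[mu]_(x in `[a, b]) g x + \int[mu]_(x in `[b, c]) g x.
Proof.
move=> ab bc.
have := @Rintegral_itvB R g (BLeft a) (BRight c) b
  (integrable_continuous_itv _ _ cg).
rewrite !bnd_simp => /(_ ab bc) /eqP; rewrite subr_eq => /eqP ->.
rewrite addrC Rintegral_itv_obnd_cbnd//.
apply: integrableS (integrable_continuous_itv b c cg) => //.
by apply: subset_itvr; rewrite bnd_simp.
Qed.

Lemma Rintegral_scale (t a b : R) : 0 < t -> a <= b ->
  \int[mu]_(s in `[a, b]) g (t * s) =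
  t^-1 * \int[mu]_(y in `[t * a, t * b]) g y.
Proof.
move=> t0 ab.
have cgt : continuous (fun s => g (t * s)) by exact: continuous_mul.
have dF : derive1 (fun x => t * x) = cst t.
  apply/funext => x; rewrite derive1E deriveM// derive_cst derive_id.
  by rewrite scaler0 addr0 [_ *: _]mulr1.
apply/(canRL (mulKf (lt0r_neq0 t0))).
rewrite -RintegralZl//; last exact: integrable_continuous_itv.
rewrite /Rintegral.
rewrite (@integration_by_substitution_increasing R (fun x => t * x))//.
- by congr fine; apply: eq_integral => x _; rewrite dF /= mulrC.
- by move=> x y _ _ xy; rewrite ltr_pM2l.
- by rewrite dF => x _; exact: cvg_cst.
- by rewrite dF; apply: is_cvg_cst.
- by rewrite dF; apply: is_cvg_cst.
- split => //.
  + by apply: cvg_at_right_filter; exact: mulrl_continuous.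
  + by apply: cvg_at_left_filter; exact: mulrl_continuous.
- exact: continuous_subspaceT.
Qed.

Hypothesis even_g : forall y, g (- y) = g y.

Lemma Rintegral_even (a b : R) : a <= b ->
  \int[mu]_(y in `[- b, - a]) g y = \int[mu]_(y in `[a, b]) g y.
Proof.
move=> ab; rewrite /Rintegral integration_by_substitution_oppr//.
  by congr fine; apply: eq_integral => x _ /=; rewrite even_g.
exact: continuous_subspaceT.
Qed.

Local Notation S y := (\int[mu]_(x in `[- y, y]) g x).

Lemma Rintegral_even_sym (y : R) : 0 <= y ->
  S y = 2 * \int[mu]_(x in `[0, y]) g x.
Proof.
move=> y0; rewrite (@Rintegral_chasles _ 0)// ?oppr_le0//.
by rewrite -[X in `[_, X]]oppr0 Rintegral_even// mulr_natl mulr2n.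
Qed.

(** Evenness is used here: it turns an integral from [- t] to a point of
[`[- t, t]] into integrals over symmetric intervals, the only ones that the
mean-zero hypothesis controls. The sign covers both cases: the part of
the interval beyond 0 is added, and for a negative endpoint the missing part
is subtracted. *)
Lemma Rintegral_even_from_opp (t b : R) : 0 < t -> -1 <= b <= 1 ->
  \int[mu]_(y in `[- t, t * b]) g y = 2^-1 * (S t + Num.sg b * S (t * `|b|)).
Proof.
move=> t0 /andP[b1 b2].
have t0' := ltW t0.
rewrite Rintegral_even_sym//.
have [b0|b0|->] := ltgtP b 0.
- have tb0 : 0 <= t * - b by rewrite mulr_ge0// oppr_ge0 ltW.
  have tbt : t * - b <= t by rewrite ler_piMr// lerNl.
  rewrite ltr0_sg// ltr0_norm// Rintegral_even_sym//.
  have -> : t * b = - (t * - b) by rewrite mulrN opprK.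
  by rewrite Rintegral_even// (Rintegral_chasles tb0 tbt); lra.
- have tb : 0 <= t * b by rewrite mulr_ge0// ltW.
  rewrite gtr0_sg// gtr0_norm// Rintegral_even_sym//.
  rewrite (@Rintegral_chasles _ 0)// ?oppr_le0//.
  by rewrite -[X in `[_, X]]oppr0 Rintegral_even//; lra.
- rewrite mulr0 -[X in `[_, X]]oppr0 Rintegral_even// sgr0; lra.
Qed.

Hypothesis mean0 : t^-1 * S t @[t --> +oo] --> (0 : R).

(** For positive [c] this is [c] times the mean at time [t * c]. *)
Lemma scaled_mean0 (c : R) : 0 <= c ->
  t^-1 * S (t * c) @[t --> +oo] --> (0 : R).
Proof.
rewrite le_eqVlt => /predU1P[<-|c0].
  under eq_fun do rewrite mulr0 oppr0 set_itv1 Rintegral_set1 mulr0.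
  exact: cvg_cst.
have : c * ((t * c)^-1 * S (t * c)) @[t --> +oo] --> c * (0 : R).
  apply: cvgMl_tmp.
  under eq_fun do rewrite (mulrC _ c).
  apply: (cvg_comp (fun t => c * t) (fun t => t^-1 * S t)) mean0.
  by apply: gt0_cvgMry => //; exact: cvg_id.
rewrite mulr0; apply: cvg_trans; apply: near_eq_cvg; near=> t.
have t0 : 0 < t by [].
by field; rewrite !gt_eqF.
Unshelve. all: by end_near. Qed.

Lemma scaled_itv_mean0 (b : R) : -1 <= b <= 1 ->
  \int[mu]_(s in `[-1, b]) g (t * s) @[t --> +oo] --> (0 : R).
Proof.
move=> b1.
have : 2^-1 * (t^-1 * S t + Num.sg b * (t^-1 * S (t * `|b|)))
    @[t --> +oo] --> 2^-1 * (0 + Num.sg b * (0 : R)).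
  apply: cvgMl_tmp; apply: cvgD; first exact: mean0.
  by apply: cvgMl_tmp; exact: scaled_mean0.
rewrite mulr0 addr0 mulr0; apply: cvg_trans; apply: near_eq_cvg; near=> t.
have t0 : 0 < t by [].
rewrite Rintegral_scale//; last by case/andP: b1.
by rewrite mulrN1 Rintegral_even_from_opp//; lra.
Unshelve. all: by end_near. Qed.

End mean_zero.

(** A Riemann-Lebesgue lemma in which the oscillating factor is only assumed
to have mean zero: the scaled functions [s => g (t * s)] are uniformly bounded
and tend to 0 against indicators of intervals, hence against every integrable
weight. *)
Lemma mean_zero_riemann_lebesgue (R : realType) (g : R -> R) (M : R)
    (w : lebesgue_type R -> R) :
  continuous g -> (forall y, g (- y) = g y) -> (forall y, `|g y| <= M) ->
  t^-1 * \int[lebesgue_measure]_(y in `[- t, t]) g y @[t --> +oo] --> (0 : R) ->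
  (@completed_lebesgue_measure R).-integrable (@itv11 R) (EFin \o w) ->
  \int[completed_lebesgue_measure]_(s in @itv11 R) (w s * g (t * s))
    @[t --> +oo] --> (0 : R).
Proof.
move=> cg even_g gM mean0 intw.
have cgt (t : R) : continuous (fun s => g (t * s)) by exact: continuous_mul.
have mgt (t : R) :
    measurable_fun (@itv11 R) (fun s : lebesgue_type R => g (t * s)).
  apply: measurable_funTS.
  apply: (measurableT_comp (continuous_measurable_fun (cgt t))).
  exact: measurable_id_completed.
apply: (weakly_null_lebesgue (phi := fun t s => g (t * s)) mgt _ _ intw).
  by move=> t s _; exact: gM.
move=> b b1; apply: cvg_trans (scaled_itv_mean0 cg even_g mean0 b1).
apply: near_eq_cvg; near=> t; rewrite /Rintegral; congr fine.
have [b1l b1r] := andP b1.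
have itvE : `[-1, b]%classic = (`[-1, 1] : set R) `&` `[-1, b].
  apply/esym/setIidPr => x; rewrite /= !in_itv/= => /andP[-> xb].
  exact: le_trans xb b1r.
rewrite [in LHS]itvE integral_mkcondr -integral_completed//.
  apply: eq_integral => x _; rewrite patchE indicE.
  by case: (x \in _); rewrite ?mul1r ?mul0r.
apply/measurable_restrict => //; rewrite setTI.
apply: measurable_funTS; apply/measurable_EFinP.
exact: (continuous_measurable_fun (cgt t)).
Unshelve. all: by end_near. Qed.

(** * Characteristic functions *)

Section characteristic_function.
Context (R : realType) (G : cumulativeBounded (0 : R) (1 : R)).
Local Notation P := (lebesgue_stieltjes_measure G).

Definition charf_re (t : R) : R := \int[P]_x cos (t * x).
Definition charf_im (t : R) : R := \int[P]_x sin (t * x).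

Lemma charfE t : charf G t = (charf_re t +i* charf_im t)%C.
Proof. by []. Qed.

Lemma charf_modE t :
  charf_mod G t = Num.sqrt (charf_re t ^+ 2 + charf_im t ^+ 2).
Proof. by []. Qed.

Lemma sqr_charf_mod t : charf_mod G t ^+ 2 = charf_re t ^+ 2 + charf_im t ^+ 2.
Proof. by rewrite charf_modE sqr_sqrtr// addr_ge0// sqr_ge0. Qed.

Lemma charf_mod_ge0 t : 0 <= charf_mod G t.
Proof. exact: sqrtr_ge0. Qed.

Lemma charf_reN t : charf_re (- t) = charf_re t.
Proof. by apply: eq_Rintegral => x _; rewrite mulNr cosN. Qed.

Lemma integrable_bounded_continuous (f : R -> R) (M : R) :
  continuous f -> (forall x, `|f x| <= M) -> P.-integrable setT (EFin \o f).
Proof.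
move=> cf fM; apply: measurable_bounded_integrable => //.
- by rewrite [X in (X < _)%E]probability_setT ltry.
- exact: continuous_measurable_fun.
- exists M; split; first exact: num_real.
  by move=> y My x _ /=; rewrite (le_trans (fM x))// ltW.
Qed.

Lemma integrable_cos_mul t : P.-integrable setT (fun x => (cos (t * x))%:E).
Proof.
apply: (integrable_bounded_continuous (M := 1)) => [|x].
  by apply: continuous_mul; exact: continuous_cos.
exact: cos_norm_le1.
Qed.

Lemma integrable_sin_mul t : P.-integrable setT (fun x => (sin (t * x))%:E).
Proof.
apply: (integrable_bounded_continuous (M := 1)) => [|x].
  by apply: continuous_mul; exact: continuous_sin.
exact: sin_norm_le1.
Qed.

Lemma charf_imN t : charf_im (- t) = - charf_im t.
Proof.
rewrite /charf_im -[RHS]mulN1r -RintegralZl//; last exact: integrable_sin_mul.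
by apply: eq_Rintegral => x _; rewrite mulNr sinN mulN1r.
Qed.

Lemma charf_modN t : charf_mod G (- t) = charf_mod G t.
Proof. by rewrite !charf_modE charf_reN charf_imN sqrrN. Qed.

(** Dominated convergence, with a constant as dominating function: [P] is a
probability measure. *)
Lemma continuous_transform (f : R -> R) (M : R) : continuous f ->
  (forall x, `|f x| <= M) -> continuous (fun t : R => \int[P]_x f (t * x)).
Proof.
move=> cf fM t.
have It : t \in `]t - 1, t + 1[%classic.
  by rewrite inE/= in_itv/= ltrBlDr !ltrDl ltr01.
apply: (@continuity_under_integral R _ _ P (fun t x => f (t * x)) setT
  measurableT (t - 1) (t + 1) _ _ (cst M) _ _ t It).
- move=> s _; apply: (integrable_bounded_continuous (M := M)) => //.
  exact: continuous_mul.
- apply: aeW => x _ s _; apply: continuous_comp; last exact: cf.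
  exact: mulrr_continuous.
- apply: (integrable_bounded_continuous (M := `|M|)) => //.
  exact: cst_continuous.
- by move=> s _; apply: aeW => x _; exact: fM.
Qed.

Lemma continuous_charf_re : continuous charf_re.
Proof. exact: (continuous_transform (@continuous_cos R) (@cos_norm_le1 R)). Qed.

Lemma continuous_charf_im : continuous charf_im.
Proof. exact: (continuous_transform (@continuous_sin R) (@sin_norm_le1 R)). Qed.

Lemma continuous_charf_mod : continuous (charf_mod G).
Proof.
move=> t; apply: (@continuous_comp _ _ _
  (fun t => charf_re t ^+ 2 + charf_im t ^+ 2) Num.sqrt).
  apply: cvgD; apply: (@continuous_comp _ _ _ _ (fun x : R => x ^+ 2)).
  - exact: continuous_charf_re.
  - exact: exprn_continuous.
  - exact: continuous_charf_im.
  - exact: exprn_continuous.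
exact: sqrt_continuous.
Qed.

Lemma charf_arg_cos (h : R -> R) t : is_charf_arg G h ->
  charf_mod G t * cos (h t) = charf_re t.
Proof.
move=> /(_ t) /(congr1 (@complex.Re R)).
by rewrite charfE /= mul0r subr0 => <-.
Qed.

Lemma charf_arg_sin (h : R -> R) t : is_charf_arg G h ->
  charf_mod G t * sin (h t) = charf_im t.
Proof.
move=> /(_ t) /(congr1 (@complex.Im R)).
by rewrite charfE /= mul0r addr0 => <-.
Qed.

Lemma charf_mod_gt0 t : charf G t != 0 -> 0 < charf_mod G t.
Proof.
move=> G0; rewrite lt_neqAle charf_mod_ge0 andbT eq_sym.
by apply: contra_neq G0 => /ComplexField.Normc.eq0_normc.
Qed.

End characteristic_function.

Section inverse_charf.
Context (R : realType) (G0 : cumulativeBounded (0 : R) (1 : R)).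
Hypothesis G0_neq0 : forall t, charf G0 t != 0.
Local Notation r0 := (charf_mod G0).

(** Real and imaginary parts of [(charf G0 y)^-1]. They are continuous even when
the argument of the characteristic function is not, which is why the sequel
is phrased with them rather than with [h0]. *)
Definition invcharf_re (y : R) : R := charf_re G0 y / r0 y ^+ 2.
Definition invcharf_im (y : R) : R := - (charf_im G0 y / r0 y ^+ 2).

Lemma invcharfE y : (charf G0 y)^-1 = (invcharf_re y +i* invcharf_im y)%C.
Proof. by rewrite /invcharf_re /invcharf_im sqr_charf_mod. Qed.

Let r0_neq0 y : r0 y != 0.
Proof. by rewrite gt_eqF// charf_mod_gt0. Qed.

Lemma continuous_div_sqr (f : R -> R) : continuous f ->
  continuous (fun y => f y / r0 y ^+ 2).
Proof.
move=> cf y; apply: cvgM; first exact: cf.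
apply: cvgV; first by rewrite expf_neq0.
apply: (@continuous_comp _ _ _ r0 (fun x : R => x ^+ 2)).
  exact: continuous_charf_mod.
exact: exprn_continuous.
Qed.

Lemma continuous_invcharf_re : continuous invcharf_re.
Proof. exact/continuous_div_sqr/continuous_charf_re. Qed.

Lemma continuous_invcharf_im : continuous invcharf_im.
Proof.
by move=> y; apply: cvgN; exact/continuous_div_sqr/continuous_charf_im.
Qed.

Lemma invcharf_reN y : invcharf_re (- y) = invcharf_re y.
Proof. by rewrite /invcharf_re charf_reN charf_modN. Qed.

Lemma invcharf_imN y : invcharf_im (- y) = - invcharf_im y.
Proof. by rewrite /invcharf_im charf_imN charf_modN mulNr. Qed.

Context (h0 : R -> R) (argh0 : is_charf_arg G0 h0).

(** Both sides are the real part of [expi a / charf G0 y]. *)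
Lemma invcharf_cos y a :
  cos (a - h0 y) / r0 y = cos a * invcharf_re y - sin a * invcharf_im y.
Proof.
rewrite cosB /invcharf_re /invcharf_im.
rewrite -(charf_arg_cos y argh0) -(charf_arg_sin y argh0).
by field; exact: r0_neq0.
Qed.

Section ratio.
Context (G : cumulativeBounded (0 : R) (1 : R)) (h : R -> R).
Hypothesis argh : is_charf_arg G h.

(** The real part of [charf G y / charf G0 y]. *)
Definition ratio_re (y : R) : R :=
  charf_re G y * invcharf_re y - charf_im G y * invcharf_im y.

Lemma Re_charf_ratio y : complex.Re (charf G y / charf G0 y) = ratio_re y.
Proof. by rewrite invcharfE. Qed.

Lemma ratio_reE y :
  charf_mod G y / r0 y * cos (h y - h0 y) = ratio_re y.
Proof.
rewrite mulrAC -mulrA invcharf_cos /ratio_re.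
by rewrite -(charf_arg_cos y argh) -(charf_arg_sin y argh); ring.
Qed.

Lemma ratio_re_le y : `|ratio_re y| <= charf_mod G y / r0 y.
Proof.
rewrite -ratio_reE normrM ger0_norm; last first.
  by rewrite divr_ge0// charf_mod_ge0.
by rewrite ler_piMr ?cos_norm_le1// divr_ge0// charf_mod_ge0.
Qed.

Lemma continuous_ratio_re : continuous ratio_re.
Proof.
move=> y; apply: cvgB; apply: cvgM.
- exact: continuous_charf_re.
- exact: continuous_invcharf_re.
- exact: continuous_charf_im.
- exact: continuous_invcharf_im.
Qed.

Lemma ratio_reN y : ratio_re (- y) = ratio_re y.
Proof.
by rewrite /ratio_re invcharf_reN invcharf_imN charf_reN charf_imN mulrNN.
Qed.

(** Only the real part of the complex mean is needed, and the modulus of the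
mean dominates it. *)
Lemma ratio_re_mean0 :
  (t^-1%:C%C * Cintegral (@lebesgue_measure R) `[- t, t]
        (fun y => charf G y / charf G0 y))
    @[t --> +oo] --> (0 : R[i]^o) ->
  t^-1 * \int[lebesgue_measure]_(y in `[- t, t]) ratio_re y
    @[t --> +oo] --> (0 : R).
Proof.
move=> /(@cvgrPdist_lt R[i] R[i]^o) Clim; apply/cvgrPdist_lt => e e0.
have /Clim : 0 < e%:C%C by rewrite ltcR.
apply: filterS => t; rewrite !sub0r normrN normrN => te.
rewrite -ltcR; apply: le_lt_trans te.
apply: le_trans (normc_ge_Re _).
rewrite (_ : complex.Re _ = t^-1 * \int[lebesgue_measure]_(y in `[- t, t])
    complex.Re (charf G y / charf G0 y)).
  rewrite (_ : \int[lebesgue_measure]_(y in _) complex.Re _ =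
               \int[lebesgue_measure]_(y in `[- t, t]) ratio_re y) //.
  by apply: eq_Rintegral => y _; exact: Re_charf_ratio.
by rewrite -[RHS]subr0 -[in RHS](mul0r (\int[lebesgue_measure]_(y in `[- t, t])
    complex.Im (charf G y / charf G0 y))).
Qed.

End ratio.

End inverse_charf.

(** * Exchange of integrals *)

(** Fubini for a bounded integrand over the product of a finite measure and the
restriction of a sigma-finite one to a set [D] of finite measure, with
real-valued integrals. The bound is only required on [D], so the product
integrand [F] carries the indicator of [D]. *)
Section fubini_bounded.
Context d1 d2 (T1 : measurableType d1) (T2 : measurableType d2) (R : realType).
Context (m1 : {finite_measure set T1 -> \bar R}).
Context (m2 : {sigma_finite_measure set T2 -> \bar R}).
Context (D : set T2) (f : T1 -> T2 -> R) (C : R).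
Hypotheses (mD : measurable D) (m2D : (m2 D < +oo)%E).
Hypothesis mf : measurable_fun setT (fun z : T1 * T2 => f z.1 z.2).
Hypothesis fC : forall x y, D y -> `|f x y| <= C.

Let F (z : T1 * T2) : \bar R := (f z.1 z.2 * \1_D z.2)%:E.

Let m1T : (m1 setT < +oo)%E.
Proof. exact: fin_num_fun_lty (fin_num_measure m1). Qed.

Let integral_section2 x :
  (\int[m2]_y F (x, y) = \int[m2]_(y in D) (f x y)%:E)%E.
Proof.
rewrite [RHS]integral_mkcond; apply: eq_integral => y _.
by rewrite patchE /F/= indicE; case: (y \in D); rewrite ?mulr1 ?mulr0.
Qed.

Let measurable_F : measurable_fun setT F.
Proof.
apply/measurable_EFinP; apply: measurable_funM => //.
exact: (measurableT_comp (measurable_indic mD) measurable_snd).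
Qed.

Let integrable_F : (m1 \x m2)%E.-integrable setT F.
Proof.
apply/(integrable12ltyP _ _ measurable_F).
have F_le x : (\int[m2]_y `|F (x, y)| <= `|C|%:E * m2 D)%E.
  have -> : (\int[m2]_y `|F (x, y)| = \int[m2]_(y in D) `|(f x y)%:E|)%E.
    rewrite [RHS]integral_mkcond; apply: eq_integral => y _.
    rewrite patchE /F/= indicE.
    by case: (y \in D); rewrite ?mulr1 ?mulr0// normr0.
  apply: integral_le_bound => //.
    apply: measurable_funTS; apply/measurable_EFinP.
    exact: (measurableT_comp mf (pair1_measurable x)).
  apply: aeW => y Dy; rewrite lee_fin.
  exact: le_trans (fC x Dy) (ler_norm _).
apply: (@le_lt_trans _ _ (\int[m1]_x (`|C|%:E * m2 D))%E); last first.
  rewrite integral_cst// lte_mul_pinfty//.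
  - by rewrite mule_ge0.
  - by rewrite fin_numM// ge0_fin_numE.
apply: ge0_le_integral => //.
- by move=> x _; exact: integral_ge0.
- apply: (measurable_fun_fubini_tonelli_F (abse \o F)) => //=.
  exact: measurableT_comp.
Qed.

Lemma integrable_bounded_section1 x : m2.-integrable D (EFin \o f x).
Proof.
apply: measurable_bounded_integrable => //.
  apply: measurable_funTS.
  exact: (measurableT_comp mf (pair1_measurable x)).
exists C; split; first exact: num_real.
by move=> y Cy s Ds; exact: le_trans (fC x Ds) (ltW Cy).
Qed.

Lemma integrable_bounded_section2 y : D y ->
  m1.-integrable setT (EFin \o f^~ y).
Proof.
move=> Dy; apply: measurable_bounded_integrable => //.
  exact: (measurableT_comp mf (pair2_measurable y)).
exists C; split; first exact: num_real.
by move=> z Cz x _; exact: le_trans (fC x Dy) (ltW Cz).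
Qed.

Let integral_sectionE x :
  (\int[m2]_y F (x, y) = (\int[m2]_(y in D) f x y)%:E)%E.
Proof.
by rewrite integral_section2 /Rintegral fineK//;
  exact: integrable_fin_num (integrable_bounded_section1 x).
Qed.

Let integral_sectionE2 y :
  (\int[m1]_x F (x, y))%E = (((fun y => \int[m1]_x f x y) \_ D) y)%:E.
Proof.
rewrite patchE; case: ifPn => [/set_mem Dy|yD].
  rewrite /Rintegral fineK; last first.
    exact: integrable_fin_num (integrable_bounded_section2 Dy).
  by apply: eq_integral => x _; rewrite /F/= indicE mem_set// mulr1.
rewrite /F/= indicE (negbTE yD); under eq_integral do rewrite mulr0.
exact: integral0.
Qed.

Lemma integrable_Rintegral1 :
  m1.-integrable setT (fun x => (\int[m2]_(y in D) f x y)%:E).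
Proof.
rewrite (_ : (fun x => _) = fubini_F m2 F); first exact: integrable_fubini_F.
by apply/funext => x; rewrite /fubini_F integral_sectionE.
Qed.

Lemma Rintegral_fubini : \int[m1]_x \int[m2]_(y in D) f x y =
  \int[m2]_(y in D) \int[m1]_x f x y.
Proof.
rewrite [RHS]Rintegral_mkcond /Rintegral; congr fine.
transitivity (\int[m1]_x \int[m2]_y F (x, y))%E.
  by apply: eq_integral => x _; rewrite integral_sectionE.
rewrite Fubini//; apply: eq_integral => y _; exact: integral_sectionE2.
Qed.

End fubini_bounded.

Section kernel.
Context (R : realType) (G0 : cumulativeBounded (0 : R) (1 : R)).
Hypothesis G0_neq0 : forall t, charf G0 t != 0.
Context (h0 : R -> R) (argh0 : is_charf_arg G0 h0).
Context (w : R -> R) (hw : admissible w).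
Local Notation lambda := (@completed_lebesgue_measure R).
Local Notation D := (@itv11 R).

Lemma admissible_integrable : lambda.-integrable D (EFin \o w).
Proof.
have [mw _ [M wM] _] := hw.
apply: measurable_bounded_integrable => //.
- exact: measurable_itv11.
- exact: completed_itv11_lty.
- exists M; split; first exact: num_real.
  by move=> y My s Ds; exact: le_trans (wM s Ds) (ltW My).
Qed.

Context (t : R).

(** The integrand of [K], extended by 0 outside [itv11] because nothing is
known about [w] there, and with its phase [h0], which need not be measurable,
eliminated. *)
Let f (x : R) (s : lebesgue_type R) : R := ((w : lebesgue_type R -> R) \_ D) s *
  (cos (t * s * x) * invcharf_re G0 (t * s) -
   sin (t * s * x) * invcharf_im G0 (t * s)).

Let f_bounded : exists C, forall x s, D s -> `|f x s| <= C.
Proof.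
have [_ _ [M wM] _] := hw.
have [A AM] := continuous_bounded_segment
  (continuous_mul (t := t) (continuous_invcharf_re G0_neq0)).
have [B BM] := continuous_bounded_segment
  (continuous_mul (t := t) (continuous_invcharf_im G0_neq0)).
exists (M * (A + B)) => x s Ds.
rewrite /f patchE mem_set// normrM ler_pM//; first exact: wM.
rewrite (le_trans (ler_normB _ _))// lerD//.
- rewrite normrM -[A]mul1r ler_pM ?cos_norm_le1//; exact: AM s Ds.
- rewrite normrM -[B]mul1r ler_pM ?sin_norm_le1//; exact: BM s Ds.
Qed.

Let measurable_f : measurable_fun setT
  (fun z : measurableTypeR R * lebesgue_type R => f z.1 z.2).
Proof.
have mwD : measurable_fun setT ((w : lebesgue_type R -> R) \_ D).
  have [mw _ _ _] := hw.
  exact: (iffLR (measurable_restrictT (w : lebesgue_type R -> R)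
    (@measurable_itv11 R)) mw).
have mts : measurable_fun setT
    (fun z : measurableTypeR R * lebesgue_type R => t * z.2).
  apply: measurable_funM; first exact: measurable_cst.
  exact: (measurableT_comp (@measurable_id_completed R) measurable_snd).
have mtsx : measurable_fun setT
    (fun z : measurableTypeR R * lebesgue_type R => t * z.2 * z.1).
  by apply: measurable_funM => //; exact: measurable_fst.
have cont (g : R -> R) (u : measurableTypeR R * lebesgue_type R -> R) :
    continuous g -> measurable_fun setT u -> measurable_fun setT (g \o u).
  by move=> /continuous_measurable_fun mg mu; exact: measurableT_comp.
apply: measurable_funM.
  exact: (measurableT_comp mwD measurable_snd).
apply: measurable_funB; apply: measurable_funM.
- exact: (cont _ _ (@continuous_cos R) mtsx).
- exact: (cont _ _ (continuous_invcharf_re G0_neq0) mts).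
- exact: (cont _ _ (@continuous_sin R) mtsx).
- exact: (cont _ _ (continuous_invcharf_im G0_neq0) mts).
Qed.

Let fE x : {in D, f x =1 K_integrand w G0 h0 t x}.
Proof.
move=> s Ds; rewrite /f /K_integrand patchE Ds -[RHS]mulrA.
by rewrite -(invcharf_cos G0_neq0 argh0).
Qed.

Lemma integrable_K_integrand x :
  lambda.-integrable D (EFin \o K_integrand w G0 h0 t x).
Proof.
have [C fC] := f_bounded.
have := integrable_bounded_section1 (m2 := lambda)
  (@measurable_itv11 R) (completed_itv11_lty R) measurable_f fC x.
apply: eq_integrable => [|s Ds]; first exact: measurable_itv11.
by rewrite /= fE.
Qed.

Context (G : cumulativeBounded (0 : R) (1 : R)).
Local Notation P := (lebesgue_stieltjes_measure G).

Lemma integrable_K : P.-integrable setT (EFin \o K w G0 h0 t).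
Proof.
have [C fC] := f_bounded.
have := integrable_Rintegral1 P (m2 := lambda) (@measurable_itv11 R)
  (completed_itv11_lty R) measurable_f fC.
apply: eq_integrable => // x _; congr EFin.
by apply: eq_Rintegral; exact: fE.
Qed.

(** After exchanging the integrals, the inner one only involves the cosine and
sine transforms of [P], that is, the real and imaginary parts of
[charf G]. *)
Lemma Rintegral_K : \int[P]_x K w G0 h0 t x =
  \int[lambda]_(s in D) (w s * ratio_re G0 G (t * s)).
Proof.
have [C fC] := f_bounded.
have <- : \int[P]_x \int[lambda]_(s in D) f x s = \int[P]_x K w G0 h0 t x.
  by apply: eq_Rintegral => x _; apply: eq_Rintegral; exact: fE.
rewrite (Rintegral_fubini P (m2 := lambda) (@measurable_itv11 R)
  (completed_itv11_lty R) measurable_f fC).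
apply: eq_Rintegral => s Ds; rewrite /f patchE Ds.
have intcos : P.-integrable setT
    (EFin \o (fun x => cos (t * s * x) * invcharf_re G0 (t * s))).
  under eq_fun do rewrite mulrC.
  exact/(integrable_fin_scale measurableT)/integrable_cos_mul.
have intsin : P.-integrable setT
    (EFin \o (fun x => sin (t * s * x) * invcharf_im G0 (t * s))).
  under eq_fun do rewrite mulrC.
  exact/(integrable_fin_scale measurableT)/integrable_sin_mul.
rewrite RintegralZl//; last exact: integrable_fin_sub.
congr (_ * _); rewrite RintegralB// !RintegralZr//.
- exact: integrable_sin_mul.
- exact: integrable_cos_mul.
Qed.

Lemma integrable_ratio :
  lambda.-integrable D (fun s => (w s * ratio_re G0 G (t * s))%:E).
Proof.
have cr : continuous (fun s => ratio_re G0 G (t * s)).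
  exact/continuous_mul/continuous_ratio_re.
have [M rM] := continuous_bounded_segment cr.
have mr : measurable_fun D (fun s : lebesgue_type R => ratio_re G0 G (t * s)).
  apply: measurable_funTS.
  apply: (measurableT_comp (continuous_measurable_fun cr)).
  exact: measurable_id_completed.
apply: (integrableMl (@measurable_itv11 R) admissible_integrable mr).
exists M; split; first exact: num_real.
by move=> y My s Ds; exact: le_trans (rM s Ds) (ltW My).
Qed.

End kernel.

(** * Properties of psi *)

Theorem theorem1 (R : realType) (U : set R)
    (F : R -> cumulativeBounded (0 : R) (1 : R)) (mu0 : R)
    (h : R -> R -> R) (w : R -> R)
    (hU : interior U !=set0) (hmu0 : U mu0)
    (hh : forall mu, U mu -> is_charf_arg (F mu) (h mu))
    (hRL : RL_type U F mu0) (hw : admissible w) :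
  (* K is a well-defined real function *)
  (forall t x, integrable (@completed_lebesgue_measure R) (@itv11 R)
     (EFin \o K_integrand w (F mu0) (h mu0) t x)) /\
  (* 1: psi is real-valued, and its formula *)
  (forall t mu, U mu ->
     [/\ integrable (lebesgue_stieltjes_measure (F mu)) setT
           (EFin \o K w (F mu0) (h mu0) t),
         integrable (@completed_lebesgue_measure R) (@itv11 R)
           (fun s =>
           (w s * (charf_mod (F mu) (t * s) / charf_mod (F mu0) (t * s))
              * cos (h mu (t * s) - h mu0 (t * s)))%:E) &
         psi w F mu0 (h mu0) t mu =
         (\int[@completed_lebesgue_measure R]_(s in @itv11 R)
           (w s * (charf_mod (F mu) (t * s) / charf_mod (F mu0) (t * s))
              * cos (h mu (t * s) - h mu0 (t * s))))%R]) /\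
  (* 2 *)
  (forall t, psi w F mu0 (h mu0) t mu0 = 1) /\
  (forall mu, U mu -> mu != mu0 ->
     psi w F mu0 (h mu0) t mu @[t --> +oo] --> (0 : R)).
Proof.
have [neq0 RL] := hRL.
have arg0 := hh mu0 hmu0.
have formE t mu : U mu -> (fun s : lebesgue_type R =>
    w s * (charf_mod (F mu) (t * s) / charf_mod (F mu0) (t * s))
        * cos (h mu (t * s) - h mu0 (t * s))) =
    (fun s => w s * ratio_re (F mu0) (F mu) (t * s)).
  move=> Umu; apply/funext => s.
  by rewrite -[LHS]mulrA (ratio_reE neq0 arg0 (hh mu Umu)).
have psiE t mu : psi w F mu0 (h mu0) t mu =
    \int[@completed_lebesgue_measure R]_(s in @itv11 R)
      (w s * ratio_re (F mu0) (F mu) (t * s)).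
  exact: Rintegral_K.
split; [|split; [|split]].
- by move=> t x; exact: integrable_K_integrand.
- move=> t mu Umu; split.
  + exact: integrable_K.
  + have := integrable_ratio neq0 hw t (F mu).
    by apply: eq_integrable => [|s _]; [exact: measurable_itv11|];
      rewrite -(congr1 (@^~ s) (formE t mu Umu)).
  + by rewrite formE.
- move=> t; rewrite psiE.
  (* here the ratio is that of a nonzero number to itself *)
  have -> : \int[@completed_lebesgue_measure R]_(s in @itv11 R)
      (w s * ratio_re (F mu0) (F mu0) (t * s)) =
      \int[@completed_lebesgue_measure R]_(s in @itv11 R) w s.
    by apply: eq_Rintegral => s _; rewrite -Re_charf_ratio divff ?mulr1.
  by have [_ _ _ w1] := hw; rewrite /Rintegral w1.
- move=> mu Umu mumu0; have [sup_lty mean0] := RL mu Umu mumu0.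
  under eq_fun do rewrite psiE.
  set S := ereal_sup _ in sup_lty.
  have leS y : ((charf_mod (F mu) y / charf_mod (F mu0) y)%:E <= S)%E.
    by apply: ereal_sup_ubound; exists y.
  have Sfin : S \is a fin_num.
    by rewrite fin_real// sup_lty (lt_le_trans _ (leS 0))// ltNyr.
  apply: (mean_zero_riemann_lebesgue (g := ratio_re (F mu0) (F mu))
                                     (M := fine S)).
  + exact: continuous_ratio_re.
  + exact: ratio_reN.
  + move=> y; apply: le_trans (ratio_re_le neq0 arg0 (hh mu Umu) y) _.
    by rewrite -lee_fin fineK.
  + exact: ratio_re_mean0.
  + exact: admissible_integrable.
Qed.
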